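(* Let $L\subseteq\{0,1\}^*\times\mathbb{N}$ be a parameterized problem with parameter $k$ such that, for some constant $c>0$, every instance with parameter $k\le c$ is a trivial instance of $L$. Let $a,a',b\colon\mathbb{N}\to\mathbb{N}$. If $L$ admits a strict $(a,b)$-kernelization and an $a'$-diminisher, then every instance $(x,k)$ of $L$ can be decided in $O(k\cdot(a(a'(b(k)))+a(|x|)))$ time. If $L$ admits a strict $(a,b)$-kernelization and a strong $a'$-diminisher, then every instance $(x,k)$ of $L$ can be decided in $O(\log k\cdot(a(a'(b(k)))+a(|x|)))$ time.
   Context: A parameterized problem is a set $L\subseteq\{0,1\}^*\times\mathbb{N}$; an instance is a pair $(x,k)$ and $k$ is its parameter. An instance being trivial means it can be decided in constant time. A strict $(a,b)$-kernelization for $L$ is an algorithm that, given any instance $(x,k)$, computes in $O(a(|x|))$ time an instance $(x',k')$ such that (i) $(x,k)\in L\iff(x',k')\in L$, (ii) $|x'|+k'\in O(b(k))$, and (iii) $k'\le k$. An $a$-diminisher for $L$ is an algorithm that, given any instance $(x,k)$, in $O(a(|x|))$ time either decides whether $(x,k)\in L$ or computes an instance $(x',k')$ with (i) $(x,k)\in L\iff(x',k')\in L$ and (ii) $k'<k$. A strong $a$-diminisher is an $a$-diminisher for which additionally $k'<k/c'$ for some constant $c'>1$.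
   Formalization: The claim fails for arbitrary a, a', b (e.g. a(n)=n, a'(n)=2^n, b(k)=k), so it is proved assuming that a and a' absorb constants (m in O(n) gives a(m) in O(a(n)), likewise a') and that b is nondecreasing; c is taken to be a positive integer. *)

(* Defs.v *)
From mathcomp Require Import all_boot all_order all_algebra.

Set Implicit Arguments.
Unset Strict Implicit.
Unset Printing Implicit Defensive.

(** ** Parameterized problems *)

Definition instance : Type := (seq bool * nat)%type.

Definition parameterized_problem : Type := instance -> Prop.

(** ** Asymptotics *)

(** [f] is in O([g]), uniformly in the index.  The additive constant allows
    constant time where the bound vanishes, e.g. [k * _] at [k = 0] or
    [log k * _] at [k = 1]; where [g] is positive it is absorbed by [C]. *)
Definition bigO (I : Type) (f g : I -> nat) : Prop :=
  exists C, forall i, f i <= C * g i + C.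

(** m \in O(n) implies f(m) \in O(f(n)): constants hidden in the argument of
    [f] may be moved out.  Every polynomial has this property, and so does
    every nondecreasing [f] with f(2n) \in O(f(n)). *)
Definition absorbs_constants (f : nat -> nat) : Prop :=
  forall C, exists D, forall m n, m <= C * n + C -> f m <= D * f n + D.

(** ** Algorithms: deterministic multi-tape Turing machines *)

(** [None] is the blank.  With several tapes, a larger tape alphabet would
    change running times by a constant factor only. *)
Definition symbol : finType := option bool.

(** Two-way infinite tapes, with cells numbered relative to the head, which is
    always on cell 0. *)
Definition tape : Type := int -> symbol.

Inductive move := MoveLeft | Stay | MoveRight.

Definition write (s : symbol) (t : tape) : tape :=
  fun i => if i == 0%R then s else t i.

Definition move_head (m : move) (t : tape) : tape :=
  match m with
  | MoveLeft => fun i => t (i - 1)%R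
  | Stay => t
  | MoveRight => fun i => t (i + 1)%R
  end.

Definition blank_tape : tape := fun _ => None.

Definition word_tape (w : seq bool) : tape :=
  fun i => if i is Posz n then onth w n else None.

(** [w] is the word that starts under the head and ends before the first
    blank; the rest of the tape is irrelevant. *)
Definition tape_holds (t : tape) (w : seq bool) : Prop :=
  forall n : nat, n <= size w -> t n%:Z%R = onth w n.

(** The word and the parameter are on separate tapes, for input and for output.
    The parameter is written in unary, in accordance with the size |x| + k of
    an instance (x, k). *)
Definition port : finType := (bool * bool)%type.
Definition in_word : port := (false, false).
Definition in_param : port := (false, true).
Definition out_word : port := (true, false).
Definition out_param : port := (true, true).

Definition unary (k : nat) : seq bool := nseq k true.

Inductive outcome := Accept | Reject | Output.

(** [halt q] is [Some o] when [q] is a halting state with outcome [o]; the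
    value of [trans] at halting states is ignored. *)
Record machine := Machine {
  state : finType;
  work_tape : finType;
  start : state;
  halt : state -> option outcome;
  trans : state -> {ffun port + work_tape -> symbol} ->
          state * (port + work_tape -> symbol * move)
}.

Section Runs.

Variable M : machine.

Definition tape_index : finType := (port + work_tape M)%type.

Definition config : Type := (state M * (tape_index -> tape))%type.

Definition step (c : config) : config :=
  if halt c.1 is Some _ then c else
  let: (q, act) := trans c.1 [ffun j => c.2 j 0%R] in
  (q, fun j => move_head (act j).2 (write (act j).1 (c.2 j))).

Definition initial (i : instance) : config :=
  (start M,
   fun j => if j == inl in_word then word_tape i.1
            else if j == inl in_param then word_tape (unary i.2)
            else blank_tape).

Definition run (t : nat) (i : instance) : config := iter t step (initial i).

(** Within [t] steps on input [i], [M] halts and answers yes or no. *)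
Definition answers (t : nat) (i : instance) (yes : bool) : Prop :=
  halt (run t i).1 = Some (if yes then Accept else Reject).

(** Within [t] steps on input [i], [M] halts and outputs the instance [i']. *)
Definition outputs (t : nat) (i i' : instance) : Prop :=
  [/\ halt (run t i).1 = Some Output,
      tape_holds ((run t i).2 (inl out_word)) i'.1 &
      tape_holds ((run t i).2 (inl out_param)) (unary i'.2)].

Definition decides (L : parameterized_problem) (t : nat) (i : instance) : Prop :=
  exists2 yes : bool, answers t i yes & (yes <-> L i).

End Runs.

(** ** Decidability, kernelizations, diminishers *)

Definition decidable_in_time (L : parameterized_problem)
    (f : instance -> nat) : Prop :=
  exists (M : machine) (time : instance -> nat),
    bigO time f /\ forall i, decides M L (time i) i.

(** A single algorithm and a single time bound serve all the instances with
    parameter at most [c]. *)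
Definition trivial_up_to (L : parameterized_problem) (c : nat) : Prop :=
  exists (M : machine) (t : nat), forall i, i.2 <= c -> decides M L t i.

Definition strict_kernelization (a b : nat -> nat)
    (L : parameterized_problem) : Prop :=
  exists (M : machine) (time : instance -> nat) (K : instance -> instance),
    [/\ bigO time (fun i => a (size i.1)),
        forall i, outputs M (time i) i (K i),
        forall i, L i <-> L (K i),
        bigO (fun i => size (K i).1 + (K i).2) (fun i => b i.2) &
        forall i, (K i).2 <= i.2].

(** [shrinks k' k] is the requirement on the new parameter [k']. *)
Definition diminisher_with (shrinks : nat -> nat -> Prop) (a : nat -> nat)
    (L : parameterized_problem) : Prop :=
  exists (M : machine) (time : instance -> nat),
    bigO time (fun i => a (size i.1)) /\
    forall i, decides M L (time i) i \/
      exists i', [/\ outputs M (time i) i i', L i <-> L i' & shrinks i'.2 i.2].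

Definition diminisher : (nat -> nat) -> parameterized_problem -> Prop :=
  diminisher_with (fun k' k => k' < k).

(** A rational constant is no restriction: a real constant greater than 1 may
    be replaced by a smaller rational one. *)
Definition strong_diminisher (a : nat -> nat) (L : parameterized_problem)
    : Prop :=
  exists2 c : rat, (1 < c)%R &
    diminisher_with (fun k' k => k' < k /\ (k'%:R < k%:R / c)%R) a L.

(* Main.v *)
(** Alternate the kernelization and the diminisher.  After the first
    kernelization all instances have size governed by [b k], so that a round
    costs O(a(a'(b(k))) + a(|x|)) steps, and the number of rounds is at most [k],
    or logarithmic in [k] when the diminisher is strong.

    On Turing machines, restarting a submachine requires clean tapes, which
    erasing might not provide within the time bound.  The loop therefore runs on
    machines that can, in one step, [trim] a tape to the word under the head;
    an output tape thus becomes an input tape at once.  They are simulated step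
    by step, with marks that delimit lazily the valid part of each tape.

    The cost a'(b(k)) of the diminisher itself is covered because either [a]
    grows at least linearly, or the kernelization runs in constant time and has
    outputs of bounded size.  If the time bound vanishes, the first kernel has
    a bounded parameter, which bounds the number of rounds. *)

Require Import Defs.
From mathcomp Require Import all_boot all_order all_algebra.
From mathcomp Require Import zify lra.
From Stdlib Require Import Classical FunctionalExtensionality.

Import Order.TTheory GRing.Theory Num.Theory.

Set Implicit Arguments.
Unset Strict Implicit.
Unset Printing Implicit Defensive.

(** * Tapes and trimming *)

Lemma tape_ext (t u : tape) :
  (forall n : nat, t (Posz n) = u (Posz n)) ->
  (forall n : nat, t (Negz n) = u (Negz n)) -> t = u.
Proof. by move=> tu_pos tu_neg; apply: functional_extensionality => -[]. Qed.

Lemma Posz_add1 (n : nat) : (Posz n + 1)%R = Posz n.+1. Proof. lia. Qed.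
Lemma Negz_add1 (n : nat) : (Negz n.+1 + 1)%R = Negz n. Proof. lia. Qed.
Lemma Negz0_add1 : (Negz 0 + 1)%R = Posz 0. Proof. by []. Qed.
Lemma Posz_sub1 (n : nat) : (Posz n.+1 - 1)%R = Posz n. Proof. lia. Qed.
Lemma Posz0_sub1 : (Posz 0 - 1)%R = Negz 0. Proof. by []. Qed.
Lemma Negz_sub1 (n : nat) : (Negz n - 1)%R = Negz n.+1. Proof. lia. Qed.

Lemma write_same (t : tape) : write (t 0%R) t = t.
Proof. by apply: tape_ext => [[|n]|n]. Qed.

Lemma move_headK (t : tape) : move_head MoveLeft (move_head MoveRight t) = t.
Proof. by apply: functional_extensionality => i /=; rewrite GRing.subrK. Qed.

Fixpoint trim_right (u : nat -> symbol) (n : nat) : symbol :=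
  match n with
  | 0 => u 0
  | n'.+1 => if u 0 is None then None else trim_right (fun k => u k.+1) n'
  end.

Definition trim (t : tape) : tape :=
  fun i => if i is Posz n then trim_right (fun k => t (Posz k)) n else None.

Lemma trim_right_blank (u : nat -> symbol) (n : nat) :
  u 0 = None -> trim_right u n = None.
Proof. by case: n => [|n] //= ->. Qed.

Lemma trim_right_word (w : seq bool) (u : nat -> symbol) :
  (forall n, n <= size w -> u n = onth w n) -> trim_right u =1 onth w.
Proof.
move=> u_w n; elim: n w u u_w => [|n IHn] w u u_w /=; first exact: u_w.
have := u_w 0 isT; case: w u_w => [|b w] u_w /= -> //.
by rewrite (IHn w) // => m m_le; apply: (u_w m.+1).
Qed.

Lemma trim_holds (t : tape) (w : seq bool) : tape_holds t w -> trim t = word_tape w.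
Proof. by move=> t_w; apply: tape_ext => n //=; apply: trim_right_word. Qed.

Lemma trim_write_blank (t : tape) : trim (write None t) = blank_tape.
Proof. by apply: tape_ext => n //=; apply: trim_right_blank. Qed.

(** * Lazy trimming by means of marks *)

(** A cell of a simulated tape carries its content and two marks.  The left mark
    [Some _] says that everything to the left of the cell is blank.  The right
    mark [Some true] says that everything to the right is blank, [Some false]
    that everything to the right is to be trimmed: it is blank from its first
    blank on.  Left marks to the right of the head, right marks to its
    left, and all that lies beyond a delimiter may be garbage: a cell is put
    right when the head enters it. *)
Definition cell : Type := (symbol * symbol * symbol)%type.
Definition content (c : cell) : symbol := c.1.1.
Definition left_mark (c : cell) : symbol := c.1.2.
Definition right_mark (c : cell) : symbol := c.2.

Definition trimmed_mark (s r : symbol) : symbol :=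
  if s is None then Some true else if r is Some true then Some true
  else Some false.

Definition enter_right (r : symbol) (c : cell) : cell :=
  match r with
  | None => (content c, None, right_mark c)
  | Some true => (None, None, Some true)
  | Some false => (content c, None, trimmed_mark (content c) (right_mark c))
  end.

Definition enter_left (l : symbol) (c : cell) : cell :=
  match l with
  | None => (content c, left_mark c, None)
  | Some _ => (None, Some true, None)
  end.

(** [p] records the last move, [inl] to the right and [inr] to the left, and
    the mark of the cell that the head has left; [None] is no pending update. *)
Definition enter (p : option (symbol + symbol)) (c : cell) : cell :=
  match p with
  | None => c
  | Some (inl r) => enter_right r c
  | Some (inr l) => enter_left l c
  end.

(** What the head would meet when walking right: [r] is the mark of the cell just left, and each
    cell is put right by it before passing on its own mark. *)
Fixpoint right_view (r : symbol) (u : nat -> cell) (n : nat) : symbol :=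
  let c := enter_right r (u 0) in
  if n is n'.+1 then right_view (right_mark c) (fun k => u k.+1) n'
  else content c.

Fixpoint left_view (l : symbol) (u : nat -> cell) (n : nat) : symbol :=
  let c := enter_left l (u 0) in
  if n is n'.+1 then left_view (left_mark c) (fun k => u k.+1) n'
  else content c.

Definition view (p : option (symbol + symbol)) (u : int -> cell) : tape :=
  let c := enter p (u 0%R) in
  fun i => match i with
  | Posz 0 => content c
  | Posz n.+1 => right_view (right_mark c) (fun k => u (Posz k.+1)) n
  | Negz n => left_view (left_mark c) (fun k => u (Negz k)) n
  end.

Lemma right_view_fresh (u : nat -> cell) (n : nat) :
  right_view (Some true) u n = None.
Proof. by elim: n u => //= n IHn u. Qed.

(** The mark [Some false] is handed from cell to cell until a blank or a mark [Some true] is met. An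
    old mark [r = Some false] is an earlier trim that is still unfinished. *)
Lemma right_view_word (r : symbol) (u : nat -> cell) (n : nat) :
  r <> Some true -> right_view (Some false) u n = trim_right (right_view r u) n.
Proof.
elim: n r u => [|n IHn] r u r_old /=; first by case: r r_old => [[]|].
have -> : content (enter_right r (u 0)) = content (u 0).
  by case: r r_old => [[]|].
case u0E: (content (u 0)) => [s|] /=; last exact: right_view_fresh.
set r' := right_mark (enter_right r (u 0)).
have r'E : r' = right_mark (u 0) \/ r' = trimmed_mark (Some s) (right_mark (u 0)).
  by rewrite /r' -u0E; case: r r_old {r'} => [[]|] // _; [right|left].
case: (right_mark (u 0)) r'E => [[]|] /= r'E.
- have -> : r' = Some true by case: r'E.
  by rewrite right_view_fresh trim_right_blank //; apply: (right_view_fresh _ 0).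
- by apply: IHn; case: r'E => ->.
- by apply: IHn; case: r'E => ->.
Qed.

Lemma right_view_trimmed (s r : symbol) (u : nat -> cell) (n : nat) :
  right_view (trimmed_mark s r) u n =
  if s is None then None else trim_right (right_view r u) n.
Proof.
case: s => [s|] /=; last exact: right_view_fresh.
case: r => [[]|] /=; [|exact: right_view_word|exact: right_view_word].
by rewrite right_view_fresh trim_right_blank //; apply: (right_view_fresh _ 0).
Qed.

Definition action : Type := (symbol * bool * move)%type.

Definition act (x : action) (t : tape) : tape :=
  move_head x.2 (if x.1.2 then trim (write x.1.1 t) else write x.1.1 t).

Definition update (x : action) (c : cell) : cell :=
  if x.1.2 then (x.1.1, Some true, trimmed_mark x.1.1 (right_mark c))
  else (x.1.1, left_mark c, right_mark c).

Definition pending (x : action) (c : cell) : option (symbol + symbol) :=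
  match x.2 with
  | MoveLeft => Some (inr (left_mark c))
  | Stay => None
  | MoveRight => Some (inl (right_mark c))
  end.

Lemma left_view_fresh (u : nat -> cell) (n : nat) :
  left_view (Some true) u n = None.
Proof. by elim: n u => //= n IHn u. Qed.

Definition merge (d l r : tape) : int -> cell := fun i => (d i, l i, r i).

(** A trim changes only the marks of the head cell; this makes it possible in one step. *)
Lemma view_write (x : action) (p : option (symbol + symbol)) (d l r : tape) :
  let c := update x (enter p (merge d l r 0%R)) in
  view None (merge (write (content c) d) (write (left_mark c) l)
                   (write (right_mark c) r)) =
  if x.1.2 then trim (write x.1.1 (view p (merge d l r)))
  else write x.1.1 (view p (merge d l r)).
Proof.
case: x => [[s [|]] m] c; apply: tape_ext => [[|n]|n] //=.
- by rewrite [right_mark _]/= right_view_trimmed.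
- exact: left_view_fresh.
Qed.

(** The mark of the cell left behind travels in the pending update. Entering clears the opposite
    mark, so that looking back shows the old cells unchanged. *)
Lemma view_shift_right (u : int -> cell) :
  view (Some (inl (right_mark (u 0%R)))) (fun i => u (i + 1)%R) =
  fun i => view None u (i + 1)%R.
Proof.
have u_pos : (fun k => u (Posz k.+1 + 1)%R) = (fun k => u (Posz k.+2)).
  by apply: functional_extensionality => k; rewrite Posz_add1.
have u_negS : (fun k => u (Negz k.+1 + 1)%R) = (fun k => u (Negz k)).
  by apply: functional_extensionality => k; rewrite Negz_add1.
apply: tape_ext => [[|n]|[|n]].
- by rewrite Posz_add1.
- by rewrite Posz_add1 /view u_pos.
- by rewrite Negz0_add1 /= Negz0_add1; case: (right_mark _) => [[]|].
- by rewrite Negz_add1 /= u_negS Negz0_add1; case: (right_mark _) => [[]|].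
Qed.

Lemma view_shift_left (u : int -> cell) :
  view (Some (inr (left_mark (u 0%R)))) (fun i => u (i - 1)%R) =
  fun i => view None u (i - 1)%R.
Proof.
have u_neg : (fun k => u (Negz k - 1)%R) = (fun k => u (Negz k.+1)).
  by apply: functional_extensionality => k; rewrite Negz_sub1.
have u_posS : (fun k => u (Posz k.+2 - 1)%R) = (fun k => u (Posz k.+1)).
  by apply: functional_extensionality => k; rewrite Posz_sub1.
apply: tape_ext => [[|[|n]]|n].
- by rewrite Posz0_sub1.
- rewrite Posz_sub1 /= Posz_sub1.
  by case: (left_mark _) => [[]|].
- rewrite Posz_sub1 /= Posz_sub1 u_posS.
  by case: (left_mark _) => [[]|].
- by rewrite Negz_sub1 /view u_neg.
Qed.

Lemma view_move (x : action) (d l r : tape) :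
  view (pending x (merge d l r 0%R))
    (merge (move_head x.2 d) (move_head x.2 l) (move_head x.2 r)) =
  move_head x.2 (view None (merge d l r)).
Proof.
case: x => [s []] //.
- exact: (view_shift_left (merge d l r)).
- exact: (view_shift_right (merge d l r)).
Qed.

Lemma right_view_unmarked (u : nat -> symbol) :
  right_view None (fun k => (u k, None, None)) =1 u.
Proof.
by move=> n; elim: n u => //= n IHn u; apply: (IHn (fun k => u k.+1)).
Qed.

Lemma left_view_unmarked (u : nat -> symbol) :
  left_view None (fun k => (u k, None, None)) =1 u.
Proof.
by move=> n; elim: n u => //= n IHn u; apply: (IHn (fun k => u k.+1)).
Qed.

Lemma view_unmarked (d : tape) : view None (merge d blank_tape blank_tape) = d.
Proof.
apply: tape_ext => [[|n]|n] //=.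
- exact: (right_view_unmarked (fun k => d (Posz k.+1))).
- exact: (left_view_unmarked (fun k => d (Negz k))).
Qed.

(** * Trimming machines and their step-by-step simulation *)

Record trimming_machine := TrimmingMachine {
  tstate : finType;
  twork : finType;
  tstart : tstate;
  thalt : tstate -> option outcome;
  ttrans : tstate -> {ffun port + twork -> symbol} ->
           tstate * (port + twork -> action)
}.

Section Simulation.

Variable M : trimming_machine.

Definition tindex : finType := (port + twork M)%type.

Definition tconfig : Type := (tstate M * (tindex -> tape))%type.

Definition tstep (c : tconfig) : tconfig :=
  if thalt c.1 is Some _ then c else
  let: (q, x) := ttrans c.1 [ffun j => c.2 j 0%R] in
  (q, fun j => act (x j) (c.2 j)).

Definition tinitial (i : instance) : tconfig :=
  (tstart M,
   fun j => if j == inl in_word then word_tape i.1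
            else if j == inl in_param then word_tape (unary i.2)
            else blank_tape).

Definition trun (t : nat) (i : instance) : tconfig := iter t tstep (tinitial i).

(** Pending updates are kept in the state because the cell that the head enters is read only in the
    next step. *)
Definition sim_state : finType :=
  (tstate M * {ffun tindex -> option (symbol + symbol)})%type.

Definition sim_work : finType := (twork M + tindex * bool)%type.

Definition sim_index : finType := (port + sim_work)%type.

Definition content_index (j : tindex) : sim_index :=
  match j with inl p => inl p | inr w => inr (inl w) end.

Definition left_index (j : tindex) : sim_index := inr (inr (j, false)).

Definition right_index (j : tindex) : sim_index := inr (inr (j, true)).

Definition sim_cell (q : sim_state) (v : sim_index -> symbol) (j : tindex) : cell :=
  enter (q.2 j) (v (content_index j), v (left_index j), v (right_index j)).

Definition sim_trans (q : sim_state) (v : {ffun sim_index -> symbol}) :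
    sim_state * (sim_index -> symbol * move) :=
  let: (q', x) := ttrans q.1 [ffun j => content (sim_cell q v j)] in
  let c j := update (x j) (sim_cell q v j) in
  ((q', [ffun j => pending (x j) (c j)]),
   fun k => match k with
     | inl p => (content (c (inl p)), (x (inl p)).2)
     | inr (inl w) => (content (c (inr w)), (x (inr w)).2)
     | inr (inr (j, false)) => (left_mark (c j), (x j).2)
     | inr (inr (j, true)) => (right_mark (c j), (x j).2)
     end).

Definition sim : machine :=
  @Machine sim_state sim_work (tstart M, [ffun=> None]) (fun q => thalt q.1)
    sim_trans.

Definition sim_view (c : config sim) : tconfig :=
  (c.1.1, fun j => view (c.1.2 j)
     (merge (c.2 (content_index j)) (c.2 (left_index j)) (c.2 (right_index j)))).

Lemma sim_view_step (c : config sim) : sim_view (step c) = tstep (sim_view c).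
Proof.
case: c => q t; rewrite /step /tstep /=.
case: (thalt q.1) => // {}.
rewrite /sim_trans.
have -> : [ffun j => content (sim_cell q [ffun k => t k 0%R] j)] =
          [ffun j => (sim_view (q, t)).2 j 0%R].
  by apply/ffunP => j; rewrite !ffunE /sim_cell !ffunE.
case: (ttrans _ _) => q' x; rewrite /sim_view /=; congr (_, _).
apply: functional_extensionality => j; rewrite ffunE.
set c := update (x j) _.
rewrite /act -view_write.
have <- : c = update (x j) (enter (q.2 j) (merge (t (content_index j)) 
   (t (left_index j)) (t (right_index j)) 0%R)).
  by rewrite /c /sim_cell !ffunE.
rewrite -view_move /=.
by case: j @c => [p|w].
Qed.

Lemma sim_view_initial (i : instance) : sim_view (initial sim i) = tinitial i.
Proof.
rewrite /sim_view /=; congr (_, _); apply: functional_extensionality => j.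
rewrite ffunE -[RHS]view_unmarked.
by case: j => [p|w].
Qed.

Lemma sim_view_run (t : nat) (i : instance) :
  sim_view (run sim t i) = trun t i.
Proof.
elim: t => [|t IHt]; first exact: sim_view_initial.
by rewrite /run /trun !iterS sim_view_step -/(run _ _ _) IHt.
Qed.

Lemma sim_answers (t : nat) (i : instance) (yes : bool) :
  thalt (trun t i).1 = Some (if yes then Accept else Reject) ->
  answers sim t i yes.
Proof. by rewrite -sim_view_run. Qed.

End Simulation.

(** * Halting runs *)

Lemma iter_stable (T : Type) (f : T -> T) (x : T) (m n : nat) :
  f (iter m f x) = iter m f x -> m <= n -> iter n f x = iter m f x.
Proof.
move=> fx /subnK <-; elim: (n - m) => [|k IHk] //.
by rewrite addSn iterS IHk.
Qed.

Lemma run_halted (M : machine) (i : instance) (m n : nat) (o : outcome) :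
  halt (run M m i).1 = Some o -> m <= n -> run M n i = run M m i.
Proof. by move=> m_halted; apply: iter_stable; rewrite /step m_halted. Qed.

Lemma tstep_halted (M : trimming_machine) (c : tconfig M) (m n : nat)
    (o : outcome) :
  thalt (iter m (@tstep M) c).1 = Some o -> m <= n ->
  iter n (@tstep M) c = iter m (@tstep M) c.
Proof. by move=> m_halted; apply: iter_stable; rewrite {1}/tstep m_halted. Qed.

(** The loop leaves a phase as soon as it halts, whereas [run] idles from then on. *)
Lemma first_halt (M : machine) (i : instance) (n : nat) (o : outcome) :
  halt (run M n i).1 = Some o ->
  exists2 m, m <= n & run M m i = run M n i /\
    forall k, k < m -> halt (run M k i).1 = None.
Proof.
move=> n_halted; pose P m := isSome (halt (run M m i).1).
have exP : exists m, P m by exists n; rewrite /P n_halted.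
case: (ex_minnP exP) => m; rewrite /P => m_halted m_min.
have m_le : m <= n by apply: m_min; rewrite n_halted.
exists m => //; split.
  by case mE: (halt _) m_halted => // _; rewrite (run_halted mE m_le).
move=> k; case kE: (halt _) => //; rewrite ltnNge => /negP[].
by apply: m_min; rewrite kE.
Qed.

(** * The loop of kernelization and diminisher *)

Section Loop.

(** [None] is the algorithm for trivial instances, [Some false] the
    kernelization and [Some true] the diminisher.  The ports of the diminisher
    are the ports of the kernelization with input and output exchanged. *)
Definition phase : Type := option bool.

Definition flipped (p : phase) : bool := p == Some true.

Definition next (p : phase) : phase :=
  if p is Some true then Some false else Some true.

Lemma flipped_next (p : phase) : flipped (next p) = ~~ flipped p.
Proof. by case: p => [[]|]. Qed.

Variable Ms : phase -> machine.

(** The two [inl] states inspect the first two cells of the unary parameter, to detect parameters at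
    most 1. *)
Definition loop_state : finType := (bool + {p : phase & state (Ms p)})%type.

Definition loop_work : finType := {p : phase & work_tape (Ms p)}.

Definition loop_index : finType := (port + loop_work)%type.

Definition embed (p : phase) (j : tape_index (Ms p)) : loop_index :=
  match j with
  | inl (o, w) => inl (o (+) flipped p, w)
  | inr w => inr (Tagged (fun p => work_tape (Ms p)) w)
  end.

Lemma embed_inj (p : phase) : injective (@embed p).
Proof.
move=> [[o w]|w] [[o' w']|w'] //= [].
- by move=> /addIb -> ->.
- by move=> /eqP; rewrite eq_Tagged /= => /eqP ->.
Qed.

Definition phase_state (p : phase) (q : state (Ms p)) : loop_state :=
  inr (Tagged (fun p => state (Ms p)) q).

Definition phase_start (p : phase) : loop_state := phase_state (start (Ms p)).

Definition is_output (p : phase) (j : loop_index) : bool :=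
  if j is inl (o, _) then o != flipped p else false.

Definition loop_halt (s : loop_state) : option outcome :=
  match s with
  | inl _ => None
  | inr (existT p q) => if halt q is Some Output then None else halt q
  end.

(** When a phase outputs, a single step trims its output tapes to their words and blanks all other
    tapes, so that the next phase finds its initial configuration. *)
Definition loop_trans (s : loop_state) (v : {ffun loop_index -> symbol}) :
    loop_state * (loop_index -> action) :=
  match s with
  | inl false =>
    if v (inl in_param) is None
    then (phase_start None, fun j => (v j, false, Stay))
    else (inl true,
          fun j => (v j, false, if j == inl in_param then MoveRight else Stay))
  | inl true =>
    (phase_start (if v (inl in_param) is None then None else Some false),
     fun j => (v j, false, if j == inl in_param then MoveLeft else Stay))
  | inr (existT p q) =>
    if halt q is Some _
    then (phase_start (next p),
          fun j => (if is_output p j then v j else None, true, Stay))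
    else let: (q', x) := trans q [ffun j => v (embed j)] in
      (phase_state q',
       fun j => if [pick k | embed k == j] is Some k
                then ((x k).1, false, (x k).2) else (v j, false, Stay))
  end.

Definition loop : trimming_machine :=
  @TrimmingMachine loop_state loop_work (inl false) loop_halt loop_trans.

Definition project (p : phase) (t : tindex loop -> tape) (j : tape_index (Ms p))
    : tape := t (embed j).
Arguments project : clear implicits.

Lemma loop_step_phase (p : phase) (q : state (Ms p)) (t : tindex loop -> tape) :
  halt q = None ->
  exists2 t', project p t' = (step (q, project p t)).2 &
    tstep ((phase_state q, t) : tconfig loop) =
    (phase_state (step (q, project p t)).1, t').
Proof.
move=> qN; rewrite /tstep /= /step /= qN.
have -> : [ffun j => [ffun j0 => t j0 0%R] (embed j)] =
          [ffun j => project p t j 0%R].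
  by apply/ffunP => j; rewrite !ffunE.
case: (trans _ _) => q' x; eexists; last by [].
apply: functional_extensionality => j; rewrite /project /=.
case: pickP => [k /eqP/embed_inj -> //|/(_ j)].
by rewrite eqxx.
Qed.

Lemma loop_run_phase (p : phase) (q : state (Ms p)) (t : tindex loop -> tape)
    (n : nat) :
  (forall m, m < n -> halt (iter m (@step _) (q, project p t)).1 = None) ->
  exists2 t', project p t' = (iter n (@step _) (q, project p t)).2 &
    iter n (@tstep loop) (phase_state q, t) =
    (phase_state (iter n (@step _) (q, project p t)).1, t').
Proof.
elim: n => [|n IHn] running; first by exists t.
have [m m_lt|t' t'E E] := IHn; first by apply: running; apply: ltnW.
rewrite !iterS E; have := running n (ltnSn n).
case: (iter n _ (q, project p t)) t'E {E} => q' u /= <- q'N.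
exact: loop_step_phase.
Qed.

(** Tapes outside phase [p] may hold anything: they are blanked when the phase ends. *)
Definition phase_answers (n : nat) (p : phase) (i : instance) (yes : bool) : Prop :=
  forall t, project p t = (initial (Ms p) i).2 ->
  thalt (iter n (@tstep loop) (phase_start p, t)).1 =
  Some (if yes then Accept else Reject).

Lemma phase_answers_leq (m n : nat) (p : phase) (i : instance) (yes : bool) :
  m <= n -> phase_answers m p i yes -> phase_answers n p i yes.
Proof.
by move=> mn m_yes t tE; rewrite (tstep_halted (m_yes t tE) mn); apply: m_yes.
Qed.

Lemma loop_phase (p : phase) (T : nat) (i : instance) (o : outcome)
    (t : tindex loop -> tape) :
  project p t = (initial (Ms p) i).2 -> halt (run (Ms p) T i).1 = Some o ->
  exists n t', [/\ n <= T, project p t' = (run (Ms p) T i).2 &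
    iter n (@tstep loop) (phase_start p, t) = (phase_state (run (Ms p) T i).1, t')].
Proof.
move=> tE /first_halt[n n_le [nE running]].
have iE : (start (Ms p), project p t) = initial (Ms p) i by rewrite tE.
have [m m_lt|t' t'E E] := @loop_run_phase p (start (Ms p)) t n.
  by rewrite iE; apply: running.
by exists n, t'; split; rewrite // -nE ?t'E ?[LHS]E iE.
Qed.

Lemma phase_answers_halt (p : phase) (T : nat) (i : instance) (yes : bool) :
  answers (Ms p) T i yes -> phase_answers T p i yes.
Proof.
move=> yesE t tE; have [n [t' [n_le _ E]]] := loop_phase tE yesE.
have nE : thalt (iter n (@tstep loop) (phase_start p, t)).1 =
          Some (if yes then Accept else Reject).
  by rewrite E /= (yesE : halt _ = _); case: (yes).
by rewrite (tstep_halted nE n_le).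
Qed.

(** The successor in [T.+1] pays for the step that switches phases. *)
Lemma phase_answers_output (p : phase) (T n : nat) (i i' : instance) (yes : bool) :
  outputs (Ms p) T i i' -> phase_answers n (next p) i' yes ->
  phase_answers (T.+1 + n) p i yes.
Proof.
move=> [TE word_i' param_i'] n_yes t tE.
have [m [t' [m_le t'E E]]] := loop_phase tE TE.
suff E' : exists2 t'', project (next p) t'' = (initial (Ms (next p)) i').2 &
    iter m.+1 (@tstep loop) (phase_start p, t) = (phase_start (next p), t'').
  case: E' => t'' t''E E'.
  have nE : thalt (iter (m.+1 + n) (@tstep loop) (phase_start p, t)).1 =
            Some (if yes then Accept else Reject).
    by rewrite addnC iterD E'; apply: n_yes.
  by rewrite (tstep_halted nE) // leq_add2r ltnS.
rewrite iterS E /tstep /= TE; eexists; last by [].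
apply: functional_extensionality => j; rewrite /project /act /=.
have out_tape w : t' (inl (~~ flipped p, w)) = (run (Ms p) T i).2 (inl (true, w)).
  by rewrite -t'E.
case: j => [[o w]|w] /=; last by rewrite trim_write_blank.
rewrite flipped_next; case: o => /=.
  by rewrite negbK eqxx trim_write_blank.
have -> : ~~ flipped p != flipped p by case: flipped.
rewrite ffunE write_same out_tape; case: w; exact: trim_holds.
Qed.

Lemma loop_start (i : instance) :
  let p := if i.2 <= 1 then None else Some false in
  exists m t, [/\ m <= 2, project p t = (initial (Ms p) i).2 &
    trun loop m i = (phase_start p, t)].
Proof.
have init (p : phase) : flipped p = false ->
    project p (tinitial loop i).2 = (initial (Ms p) i).2.
  move=> pF; apply: functional_extensionality => -[[o w]|w] //.
  by rewrite /project /= pF addbF.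
case: i init => x [|[|k]] init p.
- exists 1, (tinitial loop (x, 0)).2; split=> //; first exact: init.
  rewrite /trun /= /tstep /= !ffunE /=; congr (_, _).
  by apply: functional_extensionality => j; rewrite ffunE /act /= write_same.
- exists 2, (tinitial loop (x, 1)).2; split=> //; first exact: init.
  rewrite /trun /= /tstep /= !ffunE /= !ffunE /=; congr (_, _).
  apply: functional_extensionality => j; rewrite !ffunE /act /=.
  by rewrite !write_same; case: eqP => // _; rewrite move_headK.
- exists 2, (tinitial loop (x, k.+2)).2; split=> //; first exact: init.
  rewrite /trun /= /tstep /= !ffunE /= !ffunE /=; congr (_, _).
  apply: functional_extensionality => j; rewrite !ffunE /act /=.
  by rewrite !write_same; case: eqP => // _; rewrite move_headK.
Qed.

Lemma loop_answers (n : nat) (i : instance) (yes : bool) :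
  phase_answers n (if i.2 <= 1 then None else Some false) i yes ->
  answers (sim loop) n.+2 i yes.
Proof.
move=> n_yes; apply: sim_answers.
have [m [t [m_le tE E]]] := loop_start i.
have nE : thalt (trun loop (n + m) i).1 = Some (if yes then Accept else Reject).
  by rewrite /trun iterD -/(trun _ _ _) E; apply: n_yes.
by rewrite /trun (tstep_halted nE) // -addn2 leq_add2l.
Qed.

End Loop.

(** * Locality of runs and sublinear time *)

Lemma outputs_stable (M : machine) (m n : nat) (i i' : instance) :
  m <= n -> outputs M m i i' -> outputs M n i i'.
Proof. by move=> mn [mE mw mp]; rewrite /outputs (run_halted mE mn). Qed.

(** A step writes only under the head and renumbers the cells by at most one. *)
Lemma run_blank (M : machine) (i : instance) (t : nat) (b : bool) (n : nat) :
  t < n -> (run M t i).2 (inl (true, b)) (Posz n) = None.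
Proof.
elim: t n => [|t IHt] n t_lt; first by case: b.
rewrite /run iterS -/(run _ _ _) /step.
case: (halt _) => [o|]; first by apply: IHt; lia.
case: (trans _ _) => q x /=.
have writeE k : t < k ->
    write (x (inl (true, b))).1 ((run M t i).2 (inl (true, b))) (Posz k) = None.
  by move=> t_lt_k; rewrite /write; case: k t_lt_k => // k t_lt_k; apply: IHt.
case: n t_lt => // n t_lt; case: (x _).2 => /=.
- by rewrite Posz_sub1; apply: writeE.
- by apply: writeE; lia.
- by rewrite Posz_add1; apply: writeE; lia.
Qed.

Lemma onth_lt (T : Type) (s : seq T) (n : nat) : n < size s -> onth s n <> None.
Proof. by elim: s n => [|x s IHs] [|n] //= /IHs. Qed.

Lemma outputs_size (M : machine) (t : nat) (i i' : instance) :
  outputs M t i i' -> size i'.1 <= t.+1 /\ i'.2 <= t.+1.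
Proof.
have held_size (b : bool) w :
    tape_holds ((run M t i).2 (inl (true, b))) w -> size w <= t.+1.
  move=> w_held; rewrite leqNgt; apply/negP => t_lt.
  by apply: (onth_lt t_lt); rewrite -w_held 1?ltnW // run_blank.
by case=> _ /held_size w_le /held_size; rewrite size_nseq.
Qed.

(** One-sided, since a word and its prefix differ only to the right. Each step lowers the bound by
    at most one. *)
Definition agree_below (M : machine) (m : nat) (c d : config M) : Prop :=
  c.1 = d.1 /\ forall j (i : int), (i < m%:Z)%R -> c.2 j i = d.2 j i.

Lemma agree_below_step (M : machine) (m : nat) (c d : config M) :
  agree_below m.+1 c d -> agree_below m (step c) (step d).
Proof.
case: c d => [q t] [q' u] [/= <- tu]; rewrite /step /=.
case: (halt q) => [o|]; first by split=> //= j i i_lt; apply: tu; lia.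
have -> : [ffun j => u j 0%R] = [ffun j => t j 0%R].
  by apply/ffunP => j; rewrite !ffunE tu.
case: (trans _ _) => q1 x; split=> //= j i i_lt.
have writeE k : (k < m.+1%:Z)%R -> write (x j).1 (t j) k = write (x j).1 (u j) k.
  by move=> k_lt; rewrite /write; case: eqP => // _; apply: tu.
by case: (x j).2; apply: writeE; lia.
Qed.

Lemma agree_below_run (M : machine) (m n : nat) (i i' : instance) :
  n <= m -> agree_below m (initial M i) (initial M i') ->
  agree_below (m - n) (run M n i) (run M n i').
Proof.
elim: n => [|n IHn] nm ii'; first by rewrite subn0.
rewrite /run !iterS; apply: agree_below_step.
by rewrite subnSK //; apply: IHn => //; apply: ltnW.
Qed.

Lemma run_prefix (M : machine) (m : nat) (x : seq bool) (k : nat) :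
  (run M m (x, k)).1 = (run M m (take m x, k)).1.
Proof.
have [|//] := @agree_below_run M m m (x, k) (take m x, k) (leqnn m).
split=> // j i i_lt; rewrite /=; case: ifP => // _.
case: i i_lt => // n n_lt /=.
elim: m x n n_lt => [|m IHm] [|b x] [|n] //= n_lt; apply: IHm; lia.
Qed.

Lemma outputs_at_halt (M : machine) (m n : nat) (i i' : instance) (o : outcome) :
  outputs M n i i' -> halt (run M m i).1 = Some o -> outputs M m i i'.
Proof.
move=> n_out m_halted; case: (leqP n m) => [nm|/ltnW mn].
  exact: outputs_stable n_out.
by case: n_out; rewrite (run_halted m_halted mn).
Qed.

(** On the prefix of length [n] of a longer input the machine halts within [f n < n] steps, before
    it can notice the cut, so it does the same on the whole input. The sum bounds all [f m] with
    [m <= n]. *)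
Lemma sublinear_time_const (M : machine) (K : instance -> instance)
    (time : instance -> nat) (f : nat -> nat) (n : nat) :
  (forall i, time i <= f (size i.1)) -> f n < n ->
  (forall i, outputs M (time i) i (K i)) ->
  exists T, forall i, outputs M T i (K i).
Proof.
move=> time_le fn_lt M_K; exists (\sum_(m < n.+1) f m) => -[x k].
have f_le m : m <= n -> f m <= \sum_(m < n.+1) f m.
  by rewrite -ltnS => m_lt; rewrite (bigD1 (Ordinal m_lt)) //= leq_addr.
case: (leqP (size x) n) => [x_le|n_lt].
  apply: outputs_stable (M_K (x, k)).
  exact: leq_trans (time_le (x, k)) (f_le _ x_le).
pose t := time (take n x, k).
have t_le : t <= f n.
  by have := time_le (take n x, k); rewrite /= size_takel // ltnW.
apply: (@outputs_stable M t); first exact: leq_trans t_le (f_le n (leqnn n)).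
have [halted _ _] := M_K (take n x, k).
apply: (outputs_at_halt (o := Output) (M_K _)).
rewrite -halted -/t run_prefix [in RHS]run_prefix take_takel //.
by apply: leq_trans t_le (ltnW fn_lt).
Qed.

(** A kernelization whose time bound is somewhere smaller than the length of
    the input never reads past a fixed prefix; then it takes constant time and
    its outputs have bounded size. *)
Lemma kernelization_time (M : machine) (K : instance -> instance)
    (time : instance -> nat) (a : nat -> nat) :
  bigO time (fun i => a (size i.1)) ->
  (forall i, outputs M (time i) i (K i)) ->
  exists (time' : instance -> nat) (C : nat),
    [/\ forall i, outputs M (time' i) i (K i),
        forall i, time' i <= C * a (size i.1) + C &
        (forall n, n <= C * a n + C) \/ (forall i, size (K i).1 <= C)].
Proof.
move=> [C time_le] M_K.
case: (classic (forall n, n <= C * a n + C)) => [linear|].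
  by exists time, C; split=> //; left.
move=> /not_all_ex_not[n /negP]; rewrite -ltnNge => n_small.
have [T M_T] := sublinear_time_const (f := fun n => C * a n + C) time_le n_small M_K.
exists (fun=> T), T.+1; split=> // [i|]; first by lia.
by right=> i; have [] := outputs_size (M_T i).
Qed.

(** * Number of rounds and total time *)

(** [rank r k]: at most [r] diminishing steps are possible from the parameter [k]. *)
Lemma rounds_decide (L : parameterized_problem) (Ms : phase -> machine)
    (K : instance -> instance) (kt dt : instance -> nat)
    (shrinks : nat -> nat -> Prop) (good : instance -> Prop)
    (rank : nat -> nat -> Prop) (X : nat) :
  (forall i, outputs (Ms (Some false)) (kt i) i (K i)) ->
  (forall i, L i <-> L (K i)) ->
  (forall i, (K i).2 <= i.2) ->
  (forall i, decides (Ms (Some true)) L (dt i) i \/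
     exists i', [/\ outputs (Ms (Some true)) (dt i) i i', L i <-> L i' &
                    shrinks i'.2 i.2]) ->
  (forall i, good i -> kt i + dt (K i) + 2 <= X) ->
  (forall i i', good i -> outputs (Ms (Some true)) (dt (K i)) (K i) i' ->
     shrinks i'.2 (K i).2 -> good i') ->
  (forall r k k', rank r k -> k' <= k -> rank r k') ->
  (forall k k', rank 0 k -> ~ shrinks k' k) ->
  (forall r k k', rank r.+1 k -> shrinks k' k -> rank r k') ->
  forall r i, good i -> rank r (K i).2 ->
  exists2 yes : bool, phase_answers Ms (r.+1 * X) (Some false) i yes & (yes <-> L i).
Proof.
move=> K_out K_L K_le D_out X_ge good_next rank_le rank0 rankS.
elim=> [|r IHr] i i_good i_rank; have X_i := X_ge i i_good;
  case: (D_out (K i)) => [[yes yesE yesL]|[i' [i'_out i'_L i'_lt]]].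
- exists yes; last exact: iff_trans yesL (iff_sym (K_L i)).
  have D_yes := phase_answers_halt yesE.
  apply: phase_answers_leq (phase_answers_output (p := Some false) (K_out i) D_yes).
  by lia.
- by case: (rank0 _ _ i_rank i'_lt).
- exists yes; last exact: iff_trans yesL (iff_sym (K_L i)).
  have D_yes := phase_answers_halt yesE.
  apply: phase_answers_leq (phase_answers_output (p := Some false) (K_out i) D_yes).
  by nia.
have [|yes yesE yesL] := IHr i' (good_next _ _ i_good i'_out i'_lt).
  exact: rank_le (rankS _ _ _ i_rank i'_lt) (K_le i').
exists yes; last exact: iff_trans yesL (iff_sym (iff_trans (K_L i) i'_L)).
(* A full round consists of both phases and a switching step after each; hence the 2 in the bound on
   [X]. *)
have D_yes := phase_answers_output (p := Some true) i'_out yesE.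
apply: phase_answers_leq (phase_answers_output (p := Some false) (K_out i) D_yes).
by nia.
Qed.

(** Common to both claims: [g] is the identity or the logarithm, and [rank] measures the progress of
    the diminisher accordingly. *)
Lemma loop_decidable (L : parameterized_problem) (a a' b g : nat -> nat)
    (shrinks : nat -> nat -> Prop) (rank : nat -> nat -> Prop) (G : nat) :
  trivial_up_to L 1 -> absorbs_constants a -> absorbs_constants a' ->
  {homo b : m n / m <= n} ->
  strict_kernelization a b L -> diminisher_with shrinks a' L ->
  (forall k k', shrinks k' k -> k' < k) ->
  (forall r k k', rank r k -> k' <= k -> rank r k') ->
  (forall k k', rank 0 k -> ~ shrinks k' k) ->
  (forall r k k', rank r.+1 k -> shrinks k' k -> rank r k') ->
  (forall k, 1 < k -> 0 < g k /\ exists2 r, r <= G * g k & rank r k) ->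
  decidable_in_time L (fun i => g i.2 * (a (a' (b i.2)) + a (size i.1))).
Proof.
move=> [MT [tT T_dec]] a_abs a'_abs b_le.
move=> [MK [time [K [time_le time_out K_L K_size K_le]]]].
move=> [MD [dt [[Cd dt_le] D_out]]] shrinks_lt rank_le rank0 rankS g_rank.
have [kt [C [K_out kt_le C_alt]]] := kernelization_time time_le time_out.
have {K_size}[Cb K_size] := K_size.
have [D1 a'_le] := a'_abs Cb.
(* With [A = a' (b k)], the diminisher takes at most [E * A + E] steps on a kernel, so its output
   has size at most [E.+1 * A + E.+1]; [D2] moves [E.+1] out of [a]. *)
pose E := Cd * D1 + Cd.
have [D2 a_le] := a_abs E.+1.
pose H := Cd * (\sum_(m < C.+1) a' m) + Cd.
pose Y := C * D2.+1 + C * D2 + C + (E * C + E + H) + 2.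
pose Ms p := match p with None => MT | Some false => MK | Some true => MD end.
(* The summands pay for the rounds when [S > 0], for the rounds when [S = 0], for trivial instances
   and for the initial test. *)
pose B := 2 * G.+1 * Y + C.+2 * Y + tT + 2.
exists (sim (loop Ms)), (fun i => B * (g i.2 * (a (a' (b i.2)) + a (size i.1))) + B).
split; first by exists B.
move=> i; suff [n [yes [n_le n_yes yesL]]] : exists n yes,
    [/\ n.+2 <= B * (g i.2 * (a (a' (b i.2)) + a (size i.1))) + B,
        phase_answers Ms n (if i.2 <= 1 then None else Some false) i yes &
        yes <-> L i].
  exists yes => //; have := loop_answers n_yes.
  by rewrite /answers => n_halted; rewrite (run_halted n_halted n_le).
case: (leqP i.2 1) => [i_le|i_gt].
  have [yes yesE yesL] := T_dec i i_le; exists tT, yes; split=> //.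
    by rewrite /B; lia.
  exact: (@phase_answers_halt Ms None).
set k := i.2; set A := a' (b k); set S := a A + a (size i.1).
have dt_E j : j.2 <= k -> dt (K j) <= E * A + E.
  move=> j_le; have j_size : size (K j).1 <= Cb * b k + Cb.
    apply: leq_trans (leq_addr (K j).2 _) (leq_trans (K_size j) _).
    by rewrite leq_add2r leq_mul2l b_le ?orbT.
  have := a'_le _ _ j_size; have := dt_le (K j); rewrite /E -/A; nia.
have dt_S j : j.2 <= k -> dt (K j) <= (E * C + E + H) * S + (E * C + E + H).
  (* Either [A] is at most linear in [a A], or kernels have size at most [C] and only finitely many
     values of [a'] occur. *)
  move=> j_le; case: C_alt => [/(_ A) A_le|/(_ j) j_size].
    have := dt_E j j_le; have : A <= C * S + C by rewrite /S; nia.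
    nia.
  have : a' (size (K j).1) <= \sum_(m < C.+1) a' m.
    by rewrite (bigD1 (Ordinal (j_size : _ < C.+1))) //= leq_addr.
  have := dt_le (K j); rewrite /H; nia.
(* The invariant of the rounds: it holds for [i] and for every output of the diminisher. *)
pose good (j : instance) := j.2 <= k /\ a (size j.1) <= D2.+1 * S + D2.
have i_good : good i by split=> //; rewrite /S; nia.
have good_X j : good j -> kt j + dt (K j) + 2 <= Y * S + Y.
  move=> [j_le j_a]; have := dt_S j j_le; have := kt_le j.
  have : C * a (size j.1) <= C * (D2.+1 * S + D2) by rewrite leq_mul2l j_a orbT.
  rewrite /Y; nia.
have good_next (s : nat -> nat -> Prop) j j' : (forall k k', s k' k -> k' < k) ->
    good j -> outputs MD (dt (K j)) (K j) j' -> s j'.2 (K j).2 -> good j'.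
  move=> s_lt [j_le j_a] /outputs_size[j'_size _] /s_lt j'_lt; split.
    by apply: leq_trans (ltnW j'_lt) (leq_trans (K_le j) j_le).
  have := dt_E j j_le => dt_j; have /a_le : size j'.1 <= E.+1 * A + E.+1 by nia.
  rewrite /S; nia.
have [g_gt0 [r r_le r_rank]] := g_rank k i_gt.
have [S0|S_gt0] := posnP S.
  (* Only constant time is allowed here. As [a (size i.1) = 0], the first kernelization takes at
     most [C] steps, so the parameter drops to at most [C.+1] and then decreases in every round. *)
  have D_out' j : decides MD L (dt j) j \/
      exists i', [/\ outputs MD (dt j) j i', L j <-> L i' & i'.2 < j.2].
    case: (D_out j) => [|[j' [? ? /shrinks_lt]]]; first by left.
    by right; exists j'.
  have [||||yes yesE yesL] := @rounds_decide L Ms K kt dt (fun k' k => k' < k) good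
    (fun r k => k <= r) _ K_out K_L K_le D_out' good_X _ _ _ _ (K i).2 i i_good (leqnn _).
  - by move=> j j'; apply: (good_next (fun k' k => k' < k)).
  - by move=> r' k1 k2; lia.
  - by move=> k1 k2; lia.
  - by move=> r' k1 k2; lia.
  exists ((K i).2.+1 * (Y * S + Y)), yes; split=> //.
  have [_ K_small] := outputs_size (K_out i).
  have := kt_le i; have -> : a (size i.1) = 0 by lia.
  rewrite S0 /B; nia.
have [||yes yesE yesL] := @rounds_decide L Ms K kt dt shrinks good
    rank _ K_out K_L K_le D_out good_X _ rank_le rank0 rankS r i i_good _.
- by move=> j j'; apply: (good_next shrinks).
- exact: rank_le r_rank (K_le i).
exists (r.+1 * (Y * S + Y)), yes; split=> //.
(* Additive constants are absorbed because [S] and [g k] are positive. *)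
have : r.+1 * (Y * S + Y) <= (G.+1 * g k) * (2 * Y * S).
  by apply: leq_mul; nia.
rewrite /B; nia.
Qed.

(** * Geometric decrease and the two time bounds *)

(** By Bernoulli's inequality, any [n] above [1 / (c - 1)] works. *)
Lemma expr_ge2 (c : rat) : (1 < c)%R -> exists n, (2 <= c ^+ n :> rat)%R.
Proof.
move=> c_gt1; pose e : rat := (c - 1)%R.
have e_gt0 : (0 < e)%R by rewrite subr_gt0.
have cE : c = (1 + e)%R by rewrite /e addrC subrK.
have bernoulli n : (1 + e *+ n <= c ^+ n :> rat)%R.
  elim: n => [|n IHn]; first by rewrite mulr0n addr0 expr0.
  rewrite exprSr; apply: (@le_trans _ _ ((1 + e *+ n) * c)%R).
    have n_ge0 : (0 <= e *+ n :> rat)%R by rewrite mulrn_wge0 // ltW.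
    rewrite mulrSr; nra.
  by rewrite ler_wpM2r // ltW // (lt_trans _ c_gt1).
have [n n_gt] : exists n, (e^-1 < n%:R :> rat)%R.
  by exists (Num.bound e^-1); apply: archi_boundP; rewrite invr_ge0 ltW.
exists n; apply: le_trans (bernoulli n).
have : (e^-1 * e < n%:R * e :> rat)%R by rewrite ltr_pM2r.
rewrite mulVf ?lt0r_neq0 // mulr_natl; lra.
Qed.

Theorem theorem1 (L : parameterized_problem) (c : nat) (a a' b : nat -> nat)
    (c_gt0 : 0 < c)
    (L_trivial : trivial_up_to L c)
    (a_absorbs : absorbs_constants a)
    (a'_absorbs : absorbs_constants a')
    (b_nondecreasing : forall m n : nat, m <= n -> b m <= b n) :
  (strict_kernelization a b L -> diminisher a' L ->
     decidable_in_time L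
       (fun i => i.2 * (a (a' (b i.2)) + a (size i.1)))) /\
  (strict_kernelization a b L -> strong_diminisher a' L ->
     decidable_in_time L
       (fun i => trunc_log 2 i.2 * (a (a' (b i.2)) + a (size i.1)))).
Proof.
(* The initial test of the loop is against 1, which is at most [c]. *)
have L_trivial1 : trivial_up_to L 1.
  have [M [t M_dec]] := L_trivial; exists M, t => i i_le.
  exact: M_dec (leq_trans i_le c_gt0).
split=> [a_ker a'_dim|a_ker [d d_gt1 a'_dim]].
  apply: (loop_decidable (g := id) (rank := fun r k => k <= r) (G := 1)
    L_trivial1 a_absorbs a'_absorbs b_nondecreasing a_ker a'_dim) => //; try lia.
  by move=> k k_gt1; split; [lia | exists k; rewrite ?mul1n].
have d_gt0 : (0 < d)%R := lt_trans ltr01 d_gt1.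
have [n d_n] := expr_ge2 d_gt1.
(* Each strong step divides the parameter by [d]. From [2 <= d ^+ n] follows [k < d ^+ r] for
   [r = n * (trunc_log 2 k).+1], which is at most [2 * n * trunc_log 2 k] since the logarithm is at
   least 1. *)
apply: (loop_decidable (rank := fun r k => (k%:R < d ^+ r)%R) (G := 2 * n)
  L_trivial1 a_absorbs a'_absorbs b_nondecreasing a_ker a'_dim).
- by move=> k k' [].
- by move=> r k k' k_lt k'_le; apply: le_lt_trans k_lt; rewrite ler_nat.
- by move=> k k'; rewrite expr0 (ltr_nat _ k 1) => k_lt [k'_lt _]; lia.
- move=> r k k' k_lt [_ k'_lt]; apply: lt_le_trans k'_lt _.
  by rewrite ler_pdivrMr // -exprSr ltW.
move=> k k_gt1; have log_gt0 : 0 < trunc_log 2 k.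
  by rewrite trunc_log_gt0.
split=> //; exists (n * (trunc_log 2 k).+1); first by nia.
have /andP[_ k_lt] := trunc_log_bounds (isT : 1 < 2) (ltnW k_gt1).
apply: (@lt_le_trans _ _ ((2 ^ (trunc_log 2 k).+1)%:R)%R); first by rewrite ltr_nat.
by rewrite natrX exprM; apply: lerXn2r d_n; rewrite nnegrE ?exprn_ge0 // ltW.
Qed.
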